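(* Let $A \in \mathcal M_d(\mathbb R)$ satisfy $\rho(A) < 1$, and let $\tau$ be a delay function such that $\inf_{s \in [0, t]} \tau(s) > 0$ for every $t \geq 0$ and such that there exist $\alpha > 0$ and $\beta \in \mathbb R$ with $\mathbf n(t) \geq \alpha t + \beta$ for every $t \in \mathbb R_+$. Let $h$ be the largest delay function associated with $\tau$. Then there exist positive constants $C$ and $\gamma$ such that, for every solution $x\colon \lvert -h(0), +\infty) \to \mathbb R^d$ of $$x(t) = A x(t - \tau(t)), \qquad t \geq 0,$$ with a bounded initial condition $x_0\colon \lvert -h(0), 0) \to \mathbb R^d$, we have $$\lvert x(t)\rvert \leq C e^{-\gamma t} \sup_{s \in \lvert -h(0), 0)} \lvert x_0(s)\rvert \qquad \text{for every } t \in \mathbb R_+.$$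
   Context: $\mathbb R_+ = [0, +\infty)$, $\mathbb R_+^\ast = (0, +\infty)$, $\mathbb N = \{0, 1, 2, \dots\}$; $\mathcal M_d(\mathbb R)$ is the set of real $d \times d$ matrices, $d$ a positive integer, $\rho(A)$ is the spectral radius of $A$, and $\lvert\cdot\rvert$ is a norm on $\mathbb R^d$. For $a \leq b$ in $\mathbb R \cup \{\pm\infty\}$, the interval $\lvert a, b)$ denotes $[a, b)$ if $a > -\infty$ and $(a, b)$ if $a = -\infty$. A \emph{delay function} is any function $\tau\colon \mathbb R_+ \to \mathbb R_+^\ast$. Its \emph{largest delay function} is $h\colon \mathbb R_+ \to \mathbb R_+^\ast \cup \{+\infty\}$, $h(t) = t - \inf_{s \in [t, +\infty)} (s - \tau(s))$. A \emph{solution} is a function $x\colon \lvert -h(0), +\infty) \to \mathbb R^d$ such that $x(t) = A x(t - \tau(t))$ for every $t \in \mathbb R_+$; its \emph{initial condition} is its restriction to $\lvert -h(0), 0)$. Define $D_0 = \mathbb R$ and, for $n \geq 1$, $D_n = \{t \in \mathbb R_+ \mid t - \tau(t) \in D_{n-1}\}$. Under the condition $\inf_{[0,t]} \tau > 0$ for every $t \geq 0$, there is a unique function $\mathbf n\colon \mathbb R \to \mathbb N$ such that $t \in D_{\mathbf n(t)} \setminus D_{\mathbf n(t) + 1}$ for every $t \in \mathbb R$; this is the function $\mathbf n$ in the claim. *)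

(* Defs.v *)
From mathcomp Require Export all_boot all_order all_algebra.
From mathcomp Require Export complex.
From mathcomp Require Export all_classical all_reals all_analysis.

Set Implicit Arguments.
Unset Strict Implicit.
Unset Printing Implicit Defensive.

Import Order.TTheory GRing.Theory Num.Theory.
Import numFieldNormedType.Exports.

Local Open Scope classical_set_scope.
Local Open Scope ring_scope.

(* An arbitrary norm on R^d; the norm [`|_|] that the library puts on
   ['cV[R]_d] is only the sup norm. *)
Record is_norm (R : realType) (d : nat) (N : 'cV[R]_d -> R) : Prop := IsNorm {
  is_norm_ge0 : forall v, 0 <= N v ;
  is_norm_eq0 : forall v, N v = 0 -> v = 0 ;
  is_normZ : forall (a : R) v, N (a *: v) = `|a| * N v ;
  is_normD : forall v w, N (v + w) <= N v + N w }.

(* The eigenvalues are the complex ones. For [0 < d] the set is finite and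
   nonempty, so that [sup] is the maximum of the moduli. *)
Definition spectral_radius (R : realType) (d : nat) (A : 'M[R]_d) : R :=
  sup [set ComplexField.Normc.normc z | z in
        [set z : R[i] | eigenvalue (map_mx (real_complex R) A) z]].

(* Delay functions are total functions on [R], whose values at negative
   arguments are never used. *)
Definition is_delay (R : realType) (tau : R -> R) : Prop :=
  forall t, 0 <= t -> 0 < tau t.

Definition largest_delay (R : realType) (tau : R -> R) (t : R) : \bar R :=
  (t%:E - ereal_inf [set (s - tau s)%:E | s in [set s : R | (t <= s)%R]])%E.

(* The interval [|a, b)]: as a set of real numbers, it is [[a, b)] when [a] is
   finite and [(a, b)] when [a = -oo]. *)
Definition itv_bar (R : realType) (a b : \bar R) : set R :=
  [set t | (a <= t%:E < b)%E].

(* Functions on [|-h(0), +oo)] are represented by total functions, whose values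
   outside of this interval play no role: [t - tau t] belongs to it for every
   [t >= 0]. *)
Definition is_solution (R : realType) (d : nat) (A : 'M[R]_d) (tau : R -> R)
    (x : R -> 'cV[R]_d) : Prop :=
  forall t, 0 <= t -> x t = A *m x (t - tau t).

Definition initial_itv (R : realType) (tau : R -> R) : set R :=
  itv_bar (- largest_delay tau 0)%E 0%E.

Fixpoint iter_dom (R : realType) (tau : R -> R) (n : nat) : set R :=
  if n is m.+1 then [set t | 0 <= t /\ iter_dom tau m (t - tau t)] else setT.

(* The default value [0] of [xget] is irrelevant under the assumption of
   [iter_count_unique] below. *)
Definition iter_count (R : realType) (tau : R -> R) (t : R) : nat :=
  xget 0 [set n | (iter_dom tau n `\` iter_dom tau n.+1) t].

Lemma iter_domS (R : realType) (tau : R -> R) (n : nat) :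
  iter_dom tau n.+1 `<=` iter_dom tau n.
Proof. by elim: n => [//|n IH] t [t0 tn]; split => //; exact: IH. Qed.

Lemma iter_dom_le (R : realType) (tau : R -> R) (m n : nat) :
  (m <= n)%N -> iter_dom tau n `<=` iter_dom tau m.
Proof.
elim: n => [|n IH]; first by rewrite leqn0 => /eqP ->.
rewrite leq_eqVlt => /predU1P[-> //|mn].
exact: subset_trans (@iter_domS _ _ _) (IH mn).
Qed.

Lemma iter_count_unique (R : realType) (tau : R -> R) (t : R) :
  is_delay tau ->
  (forall u : R, 0 <= u -> 0 < inf [set tau s | s in `[0, u]]) ->
  exists! n, (iter_dom tau n `\` iter_dom tau n.+1) t.
Proof.
move=> tau0 itau0.
suff [n nP] : exists n, (iter_dom tau n `\` iter_dom tau n.+1) t.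
  exists n; split => // m [m1 m2]; case: nP => n1 n2.
  have [mn|nm|//] := ltngtP m n.
  - by case: m2; exact: iter_dom_le n1.
  - by case: n2; exact: iter_dom_le m1.
apply: contrapT => noex.
have all_dom n : iter_dom tau n t.
  by elim: n => [//|n IH]; apply: contrapT => h; apply: noex; exists n.
have t0 : 0 <= t by case: (all_dom 1%N).
set e := inf [set tau s | s in `[0, t]].
have e0 : 0 < e by exact: itau0.
have eP s : 0 <= s -> s <= t -> e <= tau s.
  move=> s0 st; apply: ge_inf; last by exists s => //=; rewrite in_itv/= s0.
  by exists 0 => _ [u /=] + <-; rewrite in_itv/= => /andP[/tau0/ltW].
have bnd n s : s <= t -> iter_dom tau n.+1 s -> n%:R * e <= s.
  elim: n s => [|n IH] s st [s0 sn]; first by rewrite mul0r.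
  have := IH _ _ sn; rewrite -natr1 mulrDl mul1r => h.
  have es := eP _ s0 st.
  rewrite -lerBrDr; apply: le_trans (h _) _; last by rewrite lerB.
  by rewrite lerBlDr (le_trans st)// lerDl ltW// tau0.
have := bnd (Num.bound (t / e)) t (lexx _) (all_dom _).
by rewrite leNgt -ltr_pdivrMr// archi_boundP// divr_ge0// ltW.
Qed.

(* Main.v *)
Require Import Defs.

(* Iterating the equation from t down to negative times takes n(t) steps, so
   that x(t) = A^n(t) x(s) for some s in |-h(0), 0), and it remains to show
   N(A^n v) <= K r^n N(v) for some r in (rho(A), 1). By Cayley-Hamilton over
   R[i], the product of the A - z over the eigenvalues z is 0; cancelling its
   factors one at a time, each of them turns an O(r^n) bound on
   A^n (A - z) p(A) into one on A^n p(A), because |z| < r. *)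

Set Implicit Arguments.
Unset Strict Implicit.
Unset Printing Implicit Defensive.

Import Order.TTheory GRing.Theory Num.Theory.
Import numFieldNormedType.Exports.
Import ComplexField.Normc.

Local Open Scope classical_set_scope.
Local Open Scope ring_scope.

(** * Geometric decay of matrix powers *)

Lemma normc_ge0 (R : realType) (z : R[i]) : 0 <= normc z.
Proof. by case: z => a b; exact: sqrtr_ge0. Qed.

Lemma normc_real (R : realType) (a : R) :
  normc (real_complex R a) = `|a|.
Proof. by rewrite /= expr0n /= addr0 sqrtr_sqr. Qed.

(* With [w n = u n.+1 - z * u n] bounded by [K * r ^+ n], the bound on [u]
   propagates by induction as soon as [K <= (r - `|z|) * K']. *)
Lemma geometric_recurrence (R : realType) (r : R) (z : R[i]) (K L : R)
    (u : nat -> R[i]) :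
  normc z < r -> normc (u 0) <= L ->
  (forall n, normc (u n.+1 - z * u n) <= K * r ^+ n) ->
  forall n, normc (u n)
    <= Num.max L (K / (r - normc z)) * r ^+ n.
Proof.
set m := normc z => zr u0 uS.
have m0 : 0 <= m by exact: normc_ge0.
have r0 : 0 <= r by rewrite ltW// (le_lt_trans m0).
set K' := Num.max _ _.
have KK' : K <= (r - m) * K'.
  by rewrite mulrC -ler_pdivrMr ?subr_gt0// le_max lexx orbT.
elim=> [|n IH]; first by rewrite expr0 mulr1 le_max u0.
rewrite -(subrK (z * u n) (u n.+1)).
apply: le_trans (le_normcD _ _) _.
rewrite normcM -/m.
apply: (@le_trans _ _ (K * r ^+ n + m * (K' * r ^+ n))).
  by rewrite lerD// ler_wpM2l.
apply: (@le_trans _ _ (((r - m) * K') * r ^+ n + m * (K' * r ^+ n))).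
  by rewrite lerD2r ler_wpM2r// exprn_ge0.
by rewrite exprS -!mulrA mulrBl subrK mulrCA.
Qed.

Section GeometricDecay.
Variables (R : realType) (d : nat) (B : 'M[R[i]]_d.+1) (r : R).

(** The parameter [p] lets the factors of the characteristic polynomial be cancelled until [p = 1];
    the bound is entrywise, so that scalar recurrences apply. *)
Definition geometric_decay (p : {poly R[i]}) : Prop :=
  exists K : R, forall n i j,
    normc (horner_mx B ('X^n * p) i j) <= K * r ^+ n.

Lemma geometric_decay_cancel (z : R[i]) (p : {poly R[i]}) :
  normc z < r ->
  geometric_decay (('X - z%:P) * p) -> geometric_decay p.
Proof.
move=> zr [K hK].
(* [L] bounds the initial values of the recurrences of all entries at once. *)
pose L := \sum_i \sum_j normc (horner_mx B p i j).
exists (Num.max L (K / (r - normc z))) => n i j.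
apply: (@geometric_recurrence _ r z K L
  (fun n => horner_mx B ('X^n * p) i j)) => // [|k].
  rewrite expr0 mul1r /L (bigD1 i)//= (bigD1 j)//= -addrA lerDl addr_ge0//.
    by apply: sumr_ge0 => *; exact: normc_ge0.
  by apply: sumr_ge0 => *; apply: sumr_ge0 => *; exact: normc_ge0.
have -> : 'X^(k.+1) * p = 'X^k * (('X - z%:P) * p) + z *: ('X^k * p).
  by rewrite exprSr mulrBl mulrBr mul_polyC scalerAr subrK mulrA.
by rewrite linearD linearZ/= !mxE addrK hK.
Qed.

Lemma geometric_decay1 :
  (forall z, eigenvalue B z -> normc z < r) ->
  geometric_decay 1.
Proof.
move=> hB; have [s hs] := closed_field_poly_normal (char_poly B).
rewrite (monicP (char_poly_monic B)) scale1r in hs.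
have : geometric_decay (\prod_(z <- s) ('X - z%:P) * 1).
  exists 0 => n i j.
  by rewrite mulr1 -hs rmorphM/= Cayley_Hamilton mulr0 mxE mul0r
    normc0.
have : forall z, z \in s -> normc z < r.
  by move=> z zs; apply: hB; rewrite eigenvalue_root_char hs root_prod_XsubC.
elim: s {hs} => [|z s IH] sr; first by rewrite big_nil mulr1.
rewrite big_cons -mulrA => /geometric_decay_cancel h.
apply: IH; last by apply: h; apply: sr; rewrite mem_head.
by move=> y ys; apply: sr; rewrite in_cons ys orbT.
Qed.

End GeometricDecay.

(** The set under [sup] must be bounded: the eigenvalues are the roots of the characteristic
    polynomial, and the sum of their moduli is an upper bound. *)
Lemma eigenvalue_le_spectral_radius (R : realType) (d : nat) (A : 'M[R]_d)
    (z : R[i]) :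
  eigenvalue (map_mx (real_complex R) A) z ->
  normc z <= spectral_radius A.
Proof.
move=> hz; apply: ub_le_sup; last by exists z.
have [s hs] := closed_field_poly_normal (char_poly (map_mx (real_complex R) A)).
rewrite (monicP (char_poly_monic _)) scale1r in hs.
exists (\sum_(y <- s) normc y) => _ [y /= hy <-].
have ys : y \in s by rewrite -root_prod_XsubC -hs -eigenvalue_root_char.
rewrite (big_rem y)//= lerDl.
by apply: sumr_ge0 => *; exact: normc_ge0.
Qed.

Lemma expmx_geometric_bound (R : realType) (d : nat) (A : 'M[R]_d.+1) (r : R) :
  spectral_radius A < r ->
  exists K : R, forall n i j, `|(A ^+ n) i j| <= K * r ^+ n.
Proof.
move=> Ar.
have [|K hK] := @geometric_decay1 _ _ (map_mx (real_complex R) A) r.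
  by move=> z /eigenvalue_le_spectral_radius /le_lt_trans; exact.
exists K => n i j; have := hK n i j.
by rewrite mulr1 rmorphXn/= horner_mx_X -rmorphXn/= mxE normc_real.
Qed.

(** * Comparison of an arbitrary norm with the coordinates *)

Section NormEquivalence.
Variables (R : realType) (d : nat) (N : 'cV[R]_d -> R).
Hypothesis hN : is_norm N.

Lemma is_norm0 : N 0 = 0.
Proof. by rewrite -(scale0r (0 : 'cV[R]_d)) (is_normZ hN) normr0 mul0r. Qed.

Lemma is_norm_le_coord v : N v <= \sum_i `|v i 0| * N (delta_mx i 0).
Proof.
rewrite {1}(matrix_sum_delta v).
apply: (@le_trans _ _ (\sum_i N (v i 0 *: delta_mx i 0))).
  elim/big_ind2 : _ => [|x a y b xa yb|i _].
  - by rewrite is_norm0.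
  - by apply: le_trans (is_normD hN _ _) _; exact: lerD.
  - by rewrite big_ord1.
by apply: ler_sum => i _; rewrite (is_normZ hN).
Qed.

Lemma coord_le_mx_norm m n (v : 'M[R]_(m, n)) i j : `|v i j| <= `|v|.
Proof.
rewrite -[leRHS]/(mx_norm v) mx_normrE.
by apply: (le_bigmax _ (fun k => `|v k.1 k.2|) (i, j)).
Qed.

Lemma is_norm_le_mx_norm (v : 'rV[R]_d) :
  N v^T <= (\sum_i N (delta_mx i 0)) * `|v|.
Proof.
apply: le_trans (is_norm_le_coord _) _; rewrite mulr_suml.
apply: ler_sum => i _; rewrite mulrC ler_wpM2l ?(is_norm_ge0 hN)//.
by rewrite mxE coord_le_mx_norm.
Qed.

(** [N] is Lipschitz for the sup norm. Row vectors are used to match [EVT_min_rV]. *)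
Lemma is_norm_trmx_continuous : continuous (fun v : 'rV[R]_d => N v^T).
Proof.
move=> v; apply/(@cvgrPdist_le _ _ _ (nbhs v) (nbhs_filter v)) => e e0.
(* Adding 1 keeps [K] positive even for the empty sum. *)
pose K := \sum_i N (delta_mx i 0) + 1.
have K0 : 0 < K by rewrite ltr_wpDl// sumr_ge0// => i _; exact: is_norm_ge0.
have dN (u w : 'rV[R]_d) : N u^T - N w^T <= K * `|u - w|.
  rewrite lerBlDr -{1}(subrK w u) linearD/=.
  apply: le_trans (is_normD hN _ _) _; rewrite lerD2r.
  apply: le_trans (is_norm_le_mx_norm _) _.
  by rewrite ler_wpM2r// /K lerDl.
have : \forall w \near v, `|v - w| <= e / K.
  apply/nbhs_normP; exists (e / K); first exact: divr_gt0.
  by move=> w /= /ltW.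
apply: filterS => w; rewrite ler_pdivlMr// mulrC => vw.
rewrite ler_norml lerNl opprB (le_trans (dN _ _))/= 1?distrC//.
exact: le_trans (dN _ _) _.
Qed.

(** On the unit sphere [S] of the sup norm, which is compact, [N] attains a positive minimum; its
    inverse serves as [c], by homogeneity. *)
Lemma coord_le_is_norm :
  exists2 c : R, 0 <= c & forall (v : 'cV[R]_d) i, `|v i 0| <= c * N v.
Proof.
pose S := [set v : 'rV[R]_d | `|v| = 1].
have Sbound (c : R) : 0 <= c -> (forall v, S v -> 1 <= c * N v^T) ->
    forall (v : 'cV[R]_d) i, `|v i 0| <= c * N v.
  move=> c0 hc v i; have [->|v0] := eqVneq v 0.
    by rewrite mxE normr0 mulr_ge0// (is_norm_ge0 hN).
  have vT0 : 0 < `|v^T|.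
    by rewrite normr_gt0; apply: contraNneq v0 => h; rewrite -(trmxK v) h trmx0.
  have /hc : S (`|v^T|^-1 *: v^T).
    by rewrite /S/= normrZ normfV normr_id mulVf// gt_eqF.
  rewrite linearZ/= trmxK (is_normZ hN) normfV normr_id mulrCA.
  rewrite ler_pdivlMl// mulr1; apply: le_trans.
  by have := coord_le_mx_norm v^T 0 i; rewrite mxE.
(* The sphere is empty when [d = 0]. *)
have [S0|/set0P/negP/negPn/eqP S0] := pselect (S !=set0); last first.
  by exists 0 => //; apply: Sbound => // v; rewrite S0.
have cS : compact S.
  apply: bounded_closed_compact.
    by exists 1; split => // x x1 v /= ->; exact: ltW.
  rewrite (_ : S = (fun v : 'rV[R]_d => `|v|) @^-1` [set 1])//.
  apply: closed_comp => [v _|]; first exact: norm_continuous.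
  exact: closed_eq.
have [v0 /set_mem Sv0 hv0] := EVT_min_rV S0 cS
  (continuous_subspaceT is_norm_trmx_continuous).
have Nv0 : 0 < N v0^T.
  rewrite lt0r (is_norm_ge0 hN) andbT; apply/eqP => /(is_norm_eq0 hN) h.
  by move: Sv0; rewrite /S/= -(trmxK v0) h trmx0 normr0 => /eqP;
     rewrite eq_sym oner_eq0.
exists (N v0^T)^-1; first by rewrite invr_ge0 ltW.
apply: Sbound; first by rewrite invr_ge0 ltW.
by move=> v Sv; rewrite ler_pdivlMl// mulr1; apply: hv0; rewrite inE.
Qed.

End NormEquivalence.

Lemma is_norm_expmx_bound (R : realType) (d : nat) (N : 'cV[R]_d.+1 -> R)
    (A : 'M[R]_d.+1) (r : R) :
  is_norm N -> spectral_radius A < r ->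
  exists K : R, forall n v, N (A ^+ n *m v) <= K * r ^+ n * N v.
Proof.
move=> hN Ar; have [K hK] := expmx_geometric_bound Ar.
have [c c0 hc] := coord_le_is_norm hN.
(* [K * r ^+ n] bounds the entries of [A ^+ n] and [c * N v] the coordinates of [v]. *)
exists (\sum_i (\sum_(j < d.+1) K * c) * N (delta_mx i 0)) => n v.
apply: le_trans (is_norm_le_coord hN _) _; rewrite -mulrA mulr_suml.
apply: ler_sum => i _; rewrite mulrAC ler_wpM2r ?(is_norm_ge0 hN)//.
rewrite mxE (le_trans (ler_norm_sum _ _ _))// mulr_suml.
by apply: ler_sum => j _; rewrite normrM mulrACA; apply: ler_pM.
Qed.

(** * Iteration of the equation back to the initial interval *)

Section Solution.
Variables (R : realType) (tau : R -> R).

Lemma initial_itvE : initial_itv tau =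
  [set t : R | (ereal_inf [set (s - tau s)%:E | s in [set s : R | (0 <= s)%R]] <= t%:E)%E
           /\ (t < 0)%R].
Proof.
rewrite /initial_itv /itv_bar /largest_delay add0e oppeK.
by apply/seteqP; split => t /=; rewrite lte_fin => /andP.
Qed.

Lemma initial_itv_delay t :
  0 <= t -> t - tau t < 0 -> initial_itv tau (t - tau t).
Proof.
move=> t0 tt; rewrite initial_itvE; split => //.
by apply: ereal_inf_lbound; exists t.
Qed.

Lemma solution_iter (d : nat) (A : 'M[R]_d.+1) (x : R -> 'cV[R]_d.+1) (n : nat)
    (t : R) :
  is_solution A tau x -> 0 <= t ->
  (iter_dom tau n `\` iter_dom tau n.+1) t ->
  exists2 s, initial_itv tau s & x t = A ^+ n *m x s.
Proof.
(* The case [n = 0] is void: [0 <= t] puts [t] in [iter_dom tau 1]. *)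
move=> hx; elim: n t => [|n IH] t t0 [] /=; first by move=> _ [].
move=> [_ tn] tn1.
have [tt|tt] := leP 0 (t - tau t).
  have [|s si xs] := IH _ tt; first by split=> // h; apply: tn1.
  by exists s => //; rewrite hx// xs mulmxA exprS.
exists (t - tau t); first exact: initial_itv_delay.
(* A negative [t - tau t] lies in [iter_dom tau n] only for [n = 0], so exactly one step was
   taken. *)
case: n {IH} tn tn1 => [_ _|n [/=]]; first by rewrite expr1 hx.
by rewrite leNgt tt.
Qed.

End Solution.

(** * From powers of [r] to an exponential rate *)

Lemma expr_le_expR (R : realType) (r y : R) (n : nat) :
  0 < r -> r <= 1 -> y <= n%:R -> r ^+ n <= expR (y * ln r).
Proof.
move=> r0 r1 yn; rewrite -{1}(lnK r0) -expRM_natl ler_expR.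
by rewrite ler_wnM2r// ln_le0.
Qed.

Theorem theorem5p14 (R : realType) (d : nat) (hd : (0 < d)%N)
    (N : 'cV[R]_d -> R) (hN : is_norm N)
    (A : 'M[R]_d) (hA : spectral_radius A < 1)
    (tau : R -> R) (htau : is_delay tau)
    (hinf : forall t : R, 0 <= t -> 0 < inf [set tau s | s in `[0, t]])
    (hcount : exists alpha beta : R, 0 < alpha /\
       forall t : R, 0 <= t -> alpha * t + beta <= (iter_count tau t)%:R) :
  exists C gamma : R, [/\ 0 < C, 0 < gamma &
    forall x : R -> 'cV[R]_d,
      is_solution A tau x ->
      has_ubound [set N (x s) | s in initial_itv tau] ->
      forall t : R, 0 <= t ->
        N (x t) <= C * expR (- (gamma * t))
                     * sup [set N (x s) | s in initial_itv tau]].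
Proof.
case: d hd N hN A hA => // d _ N hN A hA.
have [alpha [beta [alpha0 hab]]] := hcount.
(* The maximum with 0 makes [r] positive, as [ln r] requires. *)
pose r := (Num.max (spectral_radius A) 0 + 1) / 2.
have m1 : Num.max (spectral_radius A) 0 < 1 by rewrite gt_max hA ltr01.
have r1 : r < 1 by rewrite midf_lt.
have mr : Num.max (spectral_radius A) 0 < r by rewrite midf_lt.
have r0 : 0 < r by apply: le_lt_trans mr; rewrite le_max lexx orbT.
have Ar : spectral_radius A < r.
  by apply: le_lt_trans mr; rewrite le_max lexx.
have [K hK] := is_norm_expmx_bound hN Ar.
(* As [ln r < 0], the bound on [iter_count] gives [r ^+ iter_count tau t <= expR ((alpha * t + beta)
   * ln r)], which splits into these two exponentials. The maximum with 1 makes [C] positive. *)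
exists (Num.max K 1 * expR (beta * ln r)), (- (alpha * ln r)).
have K1 : 0 < Num.max K 1 by rewrite lt_max ltr01 orbT.
split.
- by rewrite mulr_gt0// expR_gt0.
- by rewrite oppr_gt0 pmulr_rlt0// ln_lt0// r0.
move=> x hx hub t t0.
(* Existence of the count rules out the default value of [xget]. *)
have hn : (iter_dom tau (iter_count tau t)
           `\` iter_dom tau (iter_count tau t).+1) t.
  have [n [nP _]] := iter_count_unique t htau hinf.
  by apply: (@xgetPex _ 0%N [set n | (iter_dom tau n `\` iter_dom tau n.+1) t]);
     exists n.
have [s si ->] := solution_iter hx t0 hn.
have Nxs : N (x s) <= sup [set N (x s) | s in initial_itv tau].
  by apply: ub_le_sup => //; exists s.
have NS0 := le_trans (is_norm_ge0 hN (x s)) Nxs.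
apply: le_trans (hK _ _) _.
apply: (@le_trans _ _ (Num.max K 1 * r ^+ iter_count tau t * N (x s))).
  rewrite ler_wpM2r ?(is_norm_ge0 hN)// ler_wpM2r ?exprn_ge0 ?(ltW r0)//.
  by rewrite le_max lexx.
apply: ler_pM => //; first by rewrite mulr_ge0 ?exprn_ge0 ?(ltW r0) ?(ltW K1).
  exact: is_norm_ge0.
rewrite -mulrA ler_pM2l// -expRD.
have -> : beta * ln r + - (- (alpha * ln r) * t) = (alpha * t + beta) * ln r.
  by rewrite mulNr opprK mulrDl addrC mulrAC.
by apply: expr_le_expR => //; [exact: ltW | exact: hab].
Qed.
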